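(* For all integers $\Delta\ge 3$ and $h\ge 2$, $\operatorname{th}_+(T(\Delta,h))=h+1$. Furthermore, with $n=|V(T(\Delta,h))|$, $$\operatorname{th}_+(T(\Delta,h))=\left\lceil 1+\log_{(\Delta-1)}\left(\frac{(\Delta-2)n+2}{\Delta}\right)\right\rceil .$$
   Context: All graphs are finite, simple and undirected. $T(\Delta,h)$ denotes the tree in which every vertex has degree $\Delta$ or $1$, and all leaves are at distance $h$ from the (unique) center vertex of the tree; that is, it is a full $(\Delta-1)$-ary tree of height $h$ whose root (the center) has one extra branch, so that the root has $\Delta$ children and every other non-leaf vertex has $\Delta-1$ children. Positive semidefinite (PSD) color change rule: each vertex of $G$ is blue or white; let $B$ be the current set of blue vertices and let $W_1,\dots,W_k$ be the vertex sets of the connected components of $G-B$. A white vertex $w\in W_i$ is colored blue (is forced by the blue vertex $v$) when $w$ is the only white neighbor of $v$ in the induced subgraph $G[W_i\cup B]$. Starting with exactly the vertices of $S\subseteq V(G)$ blue, at each time step all possible forces are performed simultaneously. $S$ is a PSD zero forcing set if eventually all vertices become blue; in that case $\operatorname{pt}_+(G;S)$ is the number of time steps needed to color all vertices blue (so it is $0$ if $S=V(G)$), and otherwise $\operatorname{pt}_+(G;S)=\infty$. Define $\operatorname{th}_+(G;S)=|S|+\operatorname{pt}_+(G;S)$, and the PSD throttling number $\operatorname{th}_+(G)=\min\{\operatorname{th}_+(G;S): S \text{ is a PSD zero forcing set of } G\}$. *)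

(* Defs.v *)
From mathcomp Require Import all_boot.

Set Implicit Arguments.
Unset Strict Implicit.
Unset Printing Implicit Defensive.

Record sgraph := SGraph {
  svertex :> finType;
  sedge : rel svertex;
  sedge_sym : symmetric sedge;
  sedge_irrefl : irreflexive sedge }.

Section PSDForcing.
Variable G : sgraph.
Implicit Types (B S W : {set G}) (v w : G).

Definition white_edge B : rel G :=
  [rel x y | [&& x \notin B, y \notin B & sedge x y]].

(* vertex sets of the connected components of G - B *)
Definition white_components B : {set {set G}} :=
  [set [set x | connect (white_edge B) w x] | w in ~: B].

(* the last condition: w is the only white neighbor of v in G[W :|: B] *)
Definition psd_force B v w : bool :=
  (v \in B) &&
  [exists W in white_components B,
     (w \in W) &&
     ([set x in W :|: B | (x \notin B) && sedge v x] == [set w])].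

Definition psd_step B : {set G} :=
  B :|: [set w | [exists v, psd_force B v w]].

Definition psd_forcing_set S : Prop :=
  exists t, iter t psd_step S == [set: G].

Lemma psd_step_sub B : B \subset psd_step B.
Proof. exact: subsetUl. Qed.

Lemma psd_iter_sub S t k : iter t psd_step S \subset iter (k + t) psd_step S.
Proof.
elim: k => [|k IHk]; first by rewrite add0n.
by rewrite addSn iterS (subset_trans IHk) ?psd_step_sub.
Qed.

Lemma psd_forcing_setP S :
  reflect (psd_forcing_set S) (iter #|G| psd_step S == [set: G]).
Proof.
apply: (iffP idP) => [full | [t /eqP full]]; first by exists #|G|.
have grow n : n <= #|iter n psd_step S| \/
    psd_step (iter n psd_step S) = iter n psd_step S.
  elim: n => [|n [leq_n|fixn]]; first by left.
  - have [eq_n|ne_n] := eqVneq (psd_step (iter n psd_step S)) (iter n psd_step S).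
      by right; rewrite iterS !eq_n.
    left; apply: leq_ltn_trans leq_n _; rewrite iterS; apply: proper_card.
    by rewrite properEneq eq_sym ne_n psd_step_sub.
  - by right; rewrite iterS !fixn.
have [big|fixp] := grow #|G|.
  by rewrite eqEcard subsetT cardsT.
have stable k : iter (k + #|G|) psd_step S = iter #|G| psd_step S.
  by elim: k => [|k IHk]; rewrite ?add0n // addSn iterS IHk.
by rewrite -(stable t) addnC eqEsubset subsetT -full psd_iter_sub.
Qed.

(* propagation time; [None] stands for infinity *)
Definition psd_pt S : option nat :=
  match psd_forcing_setP S with
  | ReflectT zfs => Some (ex_minn zfs)
  | ReflectF _ => None
  end.

Definition psd_th_of S : option nat := omap (addn #|S|) (psd_pt S).

Lemma psd_th_exists :
  exists k, [exists S : {set G}, psd_th_of S == Some k].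
Proof.
have zfsT : psd_forcing_set [set: G] by exists 0.
have [p ptT] : exists p, psd_pt [set: G] = Some p.
  by rewrite /psd_pt; case: psd_forcing_setP => // zfs; eexists.
by exists (#|[set: G]| + p); apply/existsP; exists setT; rewrite /psd_th_of ptT.
Qed.

Definition psd_th : nat := ex_minn psd_th_exists.

End PSDForcing.

(* A vertex of T(Delta, h) is the word of length at most h of the branches
   taken from the root: the first letter ranges over Delta branches, each later
   one over Delta - 1. *)
Definition Tree_word (Delta h : nat) (w : h.-bseq 'I_Delta) : bool :=
  all (fun a : 'I_Delta => a < Delta.-1) (behead w).

Definition Tree_vertex (Delta h : nat) : finType :=
  {w : h.-bseq 'I_Delta | Tree_word w}.

Section Tree.
Variables Delta h : nat.
Implicit Types x y : Tree_vertex Delta h.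

Definition Tree_seq x : seq 'I_Delta := val x.

Definition Tree_child x y : bool :=
  (size (Tree_seq y) == (size (Tree_seq x)).+1) &&
  prefix (Tree_seq x) (Tree_seq y).

Definition Tree_edge : rel (Tree_vertex Delta h) :=
  [rel x y | Tree_child x y || Tree_child y x].

Lemma Tree_edge_sym : symmetric Tree_edge.
Proof. by move=> x y; rewrite /Tree_edge /= orbC. Qed.

Lemma Tree_edge_irrefl : irreflexive Tree_edge.
Proof. by move=> x; rewrite /Tree_edge /= orbb /Tree_child eqn_leq ltnn andbF. Qed.

Definition Tree : sgraph := SGraph Tree_edge_sym Tree_edge_irrefl.

Lemma Tree_sedgeE (x y : Tree) :
  sedge x y = Tree_child x y || Tree_child y x.
Proof. by []. Qed.

Definition Tree_root : Tree := Sub [bseq] isT.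

Lemma Tree_seq_inj : injective Tree_seq.
Proof. by move=> x y /val_inj/val_inj. Qed.

Lemma Tree_of_seq (s : seq 'I_Delta) :
    size s <= h -> all (fun a : 'I_Delta => a < Delta.-1) (behead s) ->
  exists x, Tree_seq x = s.
Proof. by move=> sz ok; exists (Sub (Bseq sz) ok). Qed.

Lemma Tree_seq_size x : size (Tree_seq x) <= h.
Proof. exact: size_bseq. Qed.

Lemma Tree_seq_ok x :
  all (fun a : 'I_Delta => a < Delta.-1) (behead (Tree_seq x)).
Proof. exact: (valP x). Qed.

Lemma Tree_childP x y :
  reflect (exists a, Tree_seq y = rcons (Tree_seq x) a) (Tree_child x y).
Proof.
apply: (iffP andP) => [[/eqP sz /prefixP[s ys]]|[a ->]]; last first.
  by rewrite size_rcons eqxx prefix_rcons.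
case: s ys => [|a [|b s]] ys.
- by move/eqP: sz; rewrite ys cats0 eqn_leq ltnn andbF.
- by exists a; rewrite ys cats1.
- by move/eqP: sz; rewrite ys size_cat -[X in _ == X]addn1 eqn_add2l.
Qed.

Lemma Tree_parent y : Tree_seq y != [::] ->
  exists x, Tree_child x y.
Proof.
have szy := Tree_seq_size y; have oky := Tree_seq_ok y.
case/lastP E: (Tree_seq y) => [//|s a] _.
have [||x xs] := @Tree_of_seq s.
- by apply: leq_trans szy; rewrite E size_rcons.
- by move: oky; rewrite E; case: (s) => //= b t; rewrite all_rcons => /andP[].
by exists x; apply/Tree_childP; exists a; rewrite E xs.
Qed.

Lemma Tree_parent_inj x x' y :
  Tree_child x y -> Tree_child x' y -> x = x'.
Proof.
move=> /Tree_childP[a ya] /Tree_childP[b]; rewrite ya => /rcons_inj[eq_s _].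
exact: Tree_seq_inj.
Qed.

(* The four facts below say that this graph is the tree whose vertices all have
   degree Delta or 1 and whose leaves are all at distance h from the center. *)
Lemma Tree_dist (x : Tree) :
  (exists p, [/\ path (@sedge Tree) Tree_root p, last Tree_root p = x
               & size p = size (Tree_seq x)]) /\
  (forall p, path (@sedge Tree) Tree_root p -> last Tree_root p = x ->
     size (Tree_seq x) <= size p).
Proof.
split.
- elim: {x}(size (Tree_seq x)) {-2}x (erefl (size (Tree_seq x))) => [|n IHn] x szx.
    exists [::]; split=> //=; apply: Tree_seq_inj.
    by move/size0nil: szx => ->.
  have [|y yx] := @Tree_parent x; first by rewrite -size_eq0 szx.
  have szy : size (Tree_seq y) = n.
    by case/andP: yx => /eqP; rewrite szx => -[].
  have [p [pp lp sp]] := IHn y szy.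
  exists (rcons p x); split; last by rewrite size_rcons sp szy.
    by rewrite rcons_path pp lp Tree_sedgeE yx.
  by rewrite last_rcons.
- move=> p; elim/last_ind: p x => [|p y IHp] x; first by move=> _ <-.
  rewrite rcons_path last_rcons size_rcons => /andP[pp e] <-.
  have := IHp _ pp erefl; move: e; rewrite Tree_sedgeE; case/orP => /andP[/eqP -> _] //.
  by move/ltnW/leqW.
Qed.

Lemma Tree_connected (x y : Tree) : connect (@sedge Tree) x y.
Proof.
have root_conn (z : Tree) : connect (@sedge Tree) Tree_root z.
  by have [[p [pp lp _]] _] := Tree_dist z; apply/connectP; exists p.
apply: connect_trans (root_conn y).
by rewrite (sym_connect_sym (@sedge_sym Tree)).
Qed.

Lemma Tree_acyclic (c : seq Tree) : ucycle (@sedge Tree) c -> size c <= 2.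
Proof.
case: c => // x0 c0 cyc0; set c := x0 :: c0 in cyc0 *.
have x0c : x0 \in c by rewrite inE eqxx.
case: (arg_maxnP (fun x => size (Tree_seq x)) x0c) => x xc maxx.
have parent_of (y : Tree) : y \in c -> Tree_edge x y -> Tree_child y x.
  move=> yc /orP[/andP[/eqP sz _]|//].
  by have := maxx y yc; rewrite /= sz ltnn.
have [i s Er] := rot_to xc.
have mem_s : x :: s =i c by move=> z; rewrite -Er mem_rot.
have: ucycle (@sedge Tree) (x :: s) by rewrite -Er /ucycle rot_cycle rot_uniq.
rewrite /ucycle -(size_rot i) Er; case: s mem_s {Er} => [//|y s] mem_s.
case/lastP: s mem_s => [//|s z] mem_s.
case/andP; rewrite /= rcons_path last_rcons => /and3P[exy _ ezx].
rewrite mem_rcons inE negb_or => /and3P[_ /andP[/eqP ne_yz _] _].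
have yc : y \in c by rewrite -mem_s !inE eqxx orbT.
have zc : z \in c by rewrite -mem_s !inE mem_rcons inE eqxx !orbT.
have exz : Tree_edge x z by rewrite Tree_edge_sym.
by case: ne_yz; apply: Tree_parent_inj (parent_of y yc exy) (parent_of z zc exz).
Qed.

Lemma Tree_degree (x : Tree) : 2 <= Delta -> 0 < h ->
  #|[set y | sedge x y]| = if size (Tree_seq x) == h then 1 else Delta.
Proof.
move=> Delta_gt1 h_gt0.
have a0 : 'I_Delta := Ordinal (ltnW Delta_gt1).
pose C := [set y | Tree_child x y]; pose P := [set y | Tree_child y x].
have -> : [set y : Tree | sedge x y] = C :|: P by apply/setP => y; rewrite !inE.
have CP0 : #|C :&: P| = 0.
  apply/eqP; rewrite cards_eq0; apply/eqP/setP => y; rewrite !inE.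
  by apply/negP => /andP[/andP[/eqP s1 _] /andP[/eqP]]; rewrite s1 => s2;
     have := leqnSn (size (Tree_seq x)).+1; rewrite -s2 ltnn.
have cardP : #|P| = (Tree_seq x != [::]).
  have [x0|x0] := eqVneq (Tree_seq x) [::].
    by apply/eqP; rewrite cards_eq0; apply/eqP/setP => y;
       rewrite !inE /Tree_child x0.
  have [y yx] := Tree_parent x0; rewrite /= -(cards1 y).
  apply: eq_card => z; rewrite !inE; apply/idP/eqP => [zx|->//].
  exact: Tree_parent_inj zx yx.
rewrite cardsU CP0 subn0 cardP.
have [szx|szx] := eqVneq (size (Tree_seq x)) h.
  rewrite -size_eq0 szx -lt0n h_gt0 addn1; congr _.+1.
  apply/eqP; rewrite cards_eq0; apply/eqP/setP => y; rewrite !inE.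
  by apply/negP => /andP[/eqP sy _]; have := Tree_seq_size y; rewrite sy szx ltnn.
have {}szx : size (Tree_seq x) < h by rewrite ltn_neqAle szx Tree_seq_size.
have injC : {in C &, injective (fun y => last a0 (Tree_seq y))}.
  move=> y z; rewrite !inE => /Tree_childP[a ya] /Tree_childP[b zb].
  by rewrite ya zb !last_rcons => ab; apply: Tree_seq_inj; rewrite ya zb ab.
rewrite -(card_in_imset injC).
have imC : [set last a0 (Tree_seq y) | y in C] =
    [set a : 'I_Delta | (Tree_seq x == [::]) || (a < Delta.-1)].
  apply/setP => a; rewrite !inE; apply/imsetP/idP => [[y]|oka].
    rewrite inE => /Tree_childP[b yb] ->; rewrite yb last_rcons.
    have := Tree_seq_ok y; rewrite yb.
    by case: (Tree_seq x) => //= c s; rewrite all_rcons => /andP[].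
  have [||y ya] := @Tree_of_seq (rcons (Tree_seq x) a).
  - by rewrite size_rcons.
  - have := Tree_seq_ok x; case: (Tree_seq x) oka => //= c s oka oks.
    by rewrite all_rcons oka.
  - by exists y; rewrite ?inE; [apply/Tree_childP; exists a | rewrite ya last_rcons].
rewrite {}imC; have [x0|x0] /= := eqVneq (Tree_seq x) [::].
  rewrite addn0 -[RHS]card_ord -cardsT; apply: eq_card => a; by rewrite !inE.
have -> : [set a : 'I_Delta | a < Delta.-1] =
    [set~ Ordinal (eq_leq (prednK (ltnW Delta_gt1)))].
  apply/setP => a; rewrite !inE -val_eqE /= ltn_neqAle -ltnS.
  by rewrite (prednK (ltnW Delta_gt1)) ltn_ord andbT.
by rewrite cardsC1 card_ord addn1 (prednK (ltnW Delta_gt1)).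
Qed.

End Tree.

(* Main.v *)
Require Import Defs.
From mathcomp Require Import all_boot all_order all_algebra reals exp.
Import Order.TTheory GRing.Theory Num.Theory.

(** Why the theorem holds.  Vertices of the tree are words, and adjacent words
   differ by one last letter.

   Upper bound: color only the root.  After [k] steps the blue vertices are
   exactly the words of length at most [k] ([iter_psd_step_root]), since two
   words of length [k.+1] lie in different components of the white forest,
   so that each parent forces all its children at once.  This takes [h] steps
   with one initial blue vertex.

   Lower bound: forces only go along edges, so a vertex that is blue after [t]
   steps is at distance at most [t] from [S]; one that has length [h] then
   agrees with some vertex of [S] on its first [h - t] letters
   ([iter_psd_step_prefix]).  Every word of length [h - t] extends to one of
   length [h], hence every word of that level is a truncation of one in [S],
   and [#|S|] is at least the size of that level.  Levels grow at least like powers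
   of [2] ([Tree_level_gt]), so [#|S| >= h - t + 1] and [#|S| + t >= h + 1].

   Logarithmic form: summing the geometric series of the level sizes gives
   [(Delta - 2) n + 2 = Delta (Delta - 1) ^ h] ([card_Tree]), so the quantity
   under the ceiling is the integer [1 + h]. *)

(** * Throttling bounds from propagation in a given number of steps *)

Lemma psd_force_edge {G : sgraph} (B : {set G}) v w :
  psd_force B v w -> [/\ v \in B, w \notin B & sedge v w].
Proof.
case/andP=> vB /existsP[W /andP[_ /andP[_ /eqP/setP/(_ w)]]].
by rewrite !inE eqxx => /and3P[].
Qed.

Lemma psd_th_le (G : sgraph) (S : {set G}) t :
  iter t (@psd_step G) S = [set: G] -> psd_th G <= #|S| + t.
Proof.
move=> full; rewrite /psd_th; case: ex_minnP => k _ mink.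
have [p le_pt ptS] : exists2 p, p <= t & psd_pt S = Some p.
  rewrite /psd_pt; case: psd_forcing_setP => [zfs | []]; last first.
    by exists t; apply/eqP.
  by exists (ex_minn zfs) => //; case: ex_minnP => p _; apply; apply/eqP.
apply: (@leq_trans (#|S| + p)); last by rewrite leq_add2l.
by apply: mink; apply/existsP; exists S; rewrite /psd_th_of ptS.
Qed.

Lemma leq_psd_th (G : sgraph) k :
    (forall (S : {set G}) t, iter t (@psd_step G) S = [set: G] -> k <= #|S| + t) ->
  k <= psd_th G.
Proof.
move=> lbk; rewrite /psd_th; case: ex_minnP => th /existsP[S /eqP thS] _.
move: thS; rewrite /psd_th_of /psd_pt; case: psd_forcing_setP => //= zfs [<-].
by apply: lbk; case: ex_minnP => p /eqP.
Qed.

(** * Prefixes along edges of the tree *)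

Lemma Tree_child_size {Delta h} (x y : Tree Delta h) :
  Tree_child x y -> size (Tree_seq y) = (size (Tree_seq x)).+1.
Proof. by case/andP=> /eqP. Qed.

Lemma Tree_edge_take {Delta h} (x y : Tree Delta h) m :
    sedge x y -> m <= size (Tree_seq x) -> m <= size (Tree_seq y) ->
  take m (Tree_seq x) = take m (Tree_seq y).
Proof.
by rewrite Tree_sedgeE => /orP[] /Tree_childP[a ->] *; rewrite -cats1 takel_cat.
Qed.

Lemma Tree_edge_size {Delta h} (x y : Tree Delta h) :
  sedge x y -> size (Tree_seq y) <= (size (Tree_seq x)).+1.
Proof.
by rewrite Tree_sedgeE => /orP[] /Tree_child_size -> //; rewrite ltnW.
Qed.

(** * Propagation from the root *)

Definition Tree_ball Delta h k : {set Tree Delta h} :=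
  [set x | size (Tree_seq x) <= k].

(** White edges outside the ball join words longer than [k], so all words of a
   white component share their first [k.+1] letters. *)
Lemma connect_white_take {Delta h} k (x y : Tree Delta h) :
    connect (white_edge (Tree_ball Delta h k)) x y ->
  take k.+1 (Tree_seq x) = take k.+1 (Tree_seq y).
Proof.
case/connectP=> p; elim: p x => [|z p IHp] x /=; first by move=> _ ->.
case/andP=> /and3P[]; rewrite !inE -!ltnNge => ltkx ltkz exz pathp lastp.
by rewrite -(IHp z) //; apply: Tree_edge_take.
Qed.

(** The parent of a word [w] of length [k.+1] forces it: a sibling of [w] has the
   same length, so it could lie in the component of [w] only if it were [w]. *)
Lemma psd_step_ball Delta h k :
  psd_step (Tree_ball Delta h k) = Tree_ball Delta h k.+1.
Proof.
apply/setP=> w; rewrite in_setU !inE; apply/idP/idP.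
  case/orP=> [/leqW //|/existsP[v /psd_force_edge[]]].
  by rewrite inE => vk _ /Tree_edge_size/leq_trans; apply.
rewrite leq_eqVlt ltnS orbC => /orP[-> //|/eqP szw]; apply/orP; right.
have [|v vw] := @Tree_parent _ _ w; first by rewrite -size_eq0 szw.
have szv : size (Tree_seq v) = k.
  by have := Tree_child_size _ _ vw; rewrite szw => -[].
apply/existsP; exists v; rewrite /psd_force inE szv leqnn /=.
apply/existsP; eexists; apply/andP; split.
  by apply: (imset_f _ (x := w)); rewrite !inE szw ltnn.
rewrite inE connect0; apply/eqP/setP=> x; rewrite !inE -ltnNge.
apply/idP/eqP=> [|->]; last by rewrite connect0 szw ltnSn /Tree_edge /= vw.
case/and3P=> /orP[conn|lexk] ltkx evx; last by rewrite ltnNge lexk in ltkx.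
have szx : size (Tree_seq x) = k.+1.
  by apply/eqP; rewrite eqn_leq ltkx andbT -szv Tree_edge_size.
apply: Tree_seq_inj; have := connect_white_take _ _ _ conn.
by rewrite !take_oversize ?szw ?szx.
Qed.

Lemma iter_psd_step_root Delta h k :
  iter k (@psd_step (Tree Delta h)) [set Tree_root Delta h] = Tree_ball Delta h k.
Proof.
elim: k => [|k IHk]; last by rewrite iterS IHk psd_step_ball.
apply/setP=> x; rewrite !inE leqn0 size_eq0; apply/eqP/eqP=> [->//|x0].
exact: Tree_seq_inj.
Qed.

Lemma psd_th_Tree_le Delta h : psd_th (Tree Delta h) <= h.+1.
Proof.
rewrite -add1n -(cards1 (Tree_root Delta h)); apply: psd_th_le.
by rewrite iter_psd_step_root; apply/setP=> x; rewrite !inE Tree_seq_size.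
Qed.

(** * Sizes of the levels *)

Definition Tree_level Delta h k : {set Tree Delta h} :=
  [set x | size (Tree_seq x) == k].

Lemma card_Tree_level0 Delta h : #|Tree_level Delta h 0| = 1.
Proof.
rewrite -(cards1 (Tree_root Delta h)); apply: eq_card => x; rewrite !inE.
by rewrite size_eq0; apply/eqP/eqP=> [x0|->//]; apply: Tree_seq_inj.
Qed.

Lemma card_Tree_levelS Delta h k :
  k < h -> #|Tree_level Delta h k.+1| = Delta * Delta.-1 ^ k.
Proof.
move=> ltkh.
(* A word is a free first letter followed by letters below Delta.-1; comparing
   duplicate-free lists of words avoids packing words into vertices. *)
pose word (u : 'I_Delta * k.-tuple 'I_Delta.-1) : seq 'I_Delta :=
  u.1 :: map (widen_ord (leq_pred Delta)) u.2.
have word_inj : injective word.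
  move=> [a t] [b s] [-> /inj_map eq_ts]; congr (_, _); apply/val_inj/eq_ts.
  by move=> i j /(congr1 val) /= /val_inj.
have -> : Delta * Delta.-1 ^ k = #|{: 'I_Delta * k.-tuple 'I_Delta.-1}|.
  by rewrite card_prod card_tuple !card_ord.
rewrite !cardE -(size_map (@Tree_seq Delta h)) -(size_map word).
apply/perm_size/uniq_perm.
- by rewrite map_inj_uniq ?enum_uniq //; apply: Tree_seq_inj.
- by rewrite map_inj_uniq ?enum_uniq.
move=> s; apply/mapP/mapP=> [[x]|[[a t] _ ->]].
  rewrite mem_enum inE => /eqP szx ->; have := Tree_seq_ok x.
  case: (Tree_seq x) szx => //= a t [szt] okt.
  have [u ut] : exists u, t = map (widen_ord (leq_pred Delta)) u.
    elim: t {szt} okt => [|b t IHt] /=; first by exists [::].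
    case/andP=> ltb /IHt[u ->]; exists (Ordinal ltb :: u) => /=.
    by congr (_ :: _); apply: val_inj.
  have szu : size u == k by rewrite -szt ut size_map.
  by exists (a, Tuple szu); rewrite ?mem_enum //= /word /= ut.
have [||x xs] := @Tree_of_seq Delta h (word (a, t)).
- by rewrite /= size_map size_tuple.
- by rewrite /= all_map; apply/allP=> i _ /=.
by exists x; rewrite ?xs // mem_enum inE xs /= size_map size_tuple.
Qed.

(** The factor [Delta] of the first letter and the factors [Delta.-1] of the later
   ones are all at least [2], and [k < 2 ^ k]. *)
Lemma Tree_level_gt Delta h k :
  2 < Delta -> k <= h -> k < #|Tree_level Delta h k|.
Proof.
case: k => [|k] Delta_gt2 lekh; first by rewrite card_Tree_level0.
rewrite card_Tree_levelS //; apply: (@leq_trans (2 ^ k.+1)).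
  exact: ltn_expl.
rewrite expnS leq_mul ?(ltnW Delta_gt2) //.
case: k {lekh} => // k; rewrite leq_exp2r //.
by rewrite -ltnS prednK // (ltn_trans _ Delta_gt2).
Qed.

(** This is [n = 1 + Delta ((Delta - 1) ^ h - 1) / (Delta - 2)] with the
   denominator cleared, as the geometric series of the level sizes gives it. *)
Lemma card_Tree Delta h : 2 < Delta ->
  (Delta - 2) * #|Tree Delta h| + 2 = Delta * Delta.-1 ^ h.
Proof.
move=> Delta_gt2.
have -> : #|Tree Delta h| = 1 + Delta * \sum_(k < h) Delta.-1 ^ k.
  rewrite -sum1_card
          (partition_big (fun x : Tree Delta h => inord (size (Tree_seq x)))
             (fun k : 'I_h.+1 => true)) //=.
  under eq_bigr => k _.
    rewrite sum1dep_card (_ : [set x | _] = Tree_level Delta h k).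
      over.
    apply/setP=> x; rewrite !inE -val_eqE /= inordK //.
    by rewrite ltnS Tree_seq_size.
  rewrite big_ord_recl /= card_Tree_level0 big_distrr /=; congr (1 + _).
  by apply: eq_bigr => k _; rewrite card_Tree_levelS.
(* Delta - 2 is the predecessor of the ratio Delta.-1 of the geometric sum. *)
rewrite mulnDr muln1 mulnCA subn2 -predn_exp.
rewrite addnAC -subn2 subnK 1?ltnW // -mulnS prednK // expn_gt0.
by case: Delta Delta_gt2 => [|[]].
Qed.

(** * The lower bound *)

(** A blue vertex is within distance [k] of [S], and each edge of a path
   adds or removes one last letter: the first [size x - k] letters survive. *)
Lemma iter_psd_step_prefix {Delta h} (S : {set Tree Delta h}) k x m :
    x \in iter k (@psd_step (Tree Delta h)) S -> m <= size (Tree_seq x) - k ->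
  exists2 s, s \in S & take m (Tree_seq s) = take m (Tree_seq x).
Proof.
elim: k x => [|k IHk] x; first by exists x.
rewrite iterS in_setU inE => /orP[xB|/existsP[v /psd_force_edge[vB _ evx]]] lem.
  by apply: IHk => //; apply: leq_trans lem _; rewrite leq_sub2l.
have lemv : m <= size (Tree_seq v) - k.
  apply: leq_trans lem _; rewrite -(subSS k) leq_sub2r //.
  exact: Tree_edge_size.
have [s sS sv] := IHk v vB lemv; exists s; rewrite // sv.
by apply: Tree_edge_take => //; [apply: leq_trans lemv _ | apply: leq_trans lem _];
   rewrite leq_subr.
Qed.

(** The letter [ord0] is allowed at every position, so it can pad the word. *)
Lemma Tree_extend {Delta h} (x : Tree Delta h) :
    1 < Delta ->
  exists2 y : Tree Delta h, size (Tree_seq y) = h &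
    take (size (Tree_seq x)) (Tree_seq y) = Tree_seq x.
Proof.
case: Delta x => [|[|d]] // x _; set s := Tree_seq x.
have les : size s <= h := Tree_seq_size x.
have [||y ys] := @Tree_of_seq d.+2 h (s ++ nseq (h - size s) ord0).
- by rewrite size_cat size_nseq subnKC.
- have := Tree_seq_ok x; rewrite -/s; case: (s) => [_|a t] /=.
    by rewrite subn0; apply/allP=> b /mem_behead; rewrite mem_nseq => /andP[_ /eqP->].
  by rewrite all_cat => ->; rewrite all_nseq orbT.
by exists y; rewrite ys ?size_cat ?size_nseq ?subnKC // take_size_cat.
Qed.

Lemma psd_th_Tree_ge Delta h : 2 < Delta -> h < psd_th (Tree Delta h).
Proof.
move=> Delta_gt2; apply: leq_psd_th => S t full; set m := h - t.
have ltm : m < #|Tree_level Delta h m| by rewrite Tree_level_gt ?leq_subr.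
apply: (@leq_trans (m.+1 + t)); first by rewrite addSn ltnS addnC -leq_subLR.
rewrite leq_add2r; apply: leq_trans ltm _.
(* The truncations to m letters of the words of S include the level m. *)
rewrite !cardE -(size_map (@Tree_seq Delta h)).
rewrite -(size_map (fun s => take m (Tree_seq s)) (enum S)).
apply: uniq_leq_size.
  by rewrite map_inj_uniq ?enum_uniq //; apply: Tree_seq_inj.
move=> _ /mapP[x xm ->]; move: xm; rewrite mem_enum inE => /eqP szx.
have [y szy yx] := Tree_extend x (ltnW Delta_gt2).
have [||s sS sy] := @iter_psd_step_prefix _ _ S t y m; rewrite ?full ?inE ?szy //.
by apply/mapP; exists s; rewrite ?mem_enum // sy -szx yx.
Qed.

(** * The throttling number and its logarithmic form *)

Local Open Scope ring_scope.

Theorem proposition4p8 (R : realType) (Delta h : nat)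
    (hDelta : (3 <= Delta)%N) (hh : (2 <= h)%N) :
  psd_th (Tree Delta h) = h.+1 /\
  (psd_th (Tree Delta h))%:Z =
    Num.ceil (1 + ln (((Delta%:R - 2) * #|Tree Delta h|%:R + 2) / Delta%:R)
                  / ln (Delta%:R - 1) : R).
Proof.
have thE : psd_th (Tree Delta h) = h.+1.
  by apply/eqP; rewrite eqn_leq psd_th_Tree_le psd_th_Tree_ge.
split=> //; rewrite thE.
have Delta_gt0 : (0 < Delta)%N by apply: leq_trans hDelta.
have -> : (Delta%:R - 1 : R) = Delta.-1%:R by rewrite -subn1 natrB.
have -> : (Delta%:R - 2) * #|Tree Delta h|%:R + 2 = Delta%:R * Delta.-1%:R ^+ h :> R.
  by rewrite -natrX -natrM -card_Tree // natrD natrM natrB // ltnW.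
have Delta1_gt1 : 1 < Delta.-1%:R :> R by rewrite ltr1n -ltnS prednK.
rewrite mulrAC divff ?pnatr_eq0 -?lt0n // mul1r lnXn ?(lt_trans ltr01) //.
rewrite -[ln _ *+ h]mulr_natl mulfK; last by rewrite gt_eqF // ln_gt0.
by rewrite nat1r -[h.+1%:R]/(h.+1%:Z%:~R) intrKceil.
Qed.
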